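(* Let $n=1$, let $\mathcal{I}=\{0,1,\dots,N\}$ with $N\in\mathbb{N}$ finite, and let the strong Atkinson condition (SAC) be satisfied. Then the following hold. (i) A linear relation $T$ is a self-adjoint extension of $T_{\min}$ if and only if there exist matrices $F,G\in\mathbb{C}^{2\times2}$ such that $$\operatorname{rank}(F,G)=2,\qquad FG^*=GF^*,\qquad(\ast)$$ and $$T=T_{F,G}:=\{\{\tilde z,\tilde f\}\in T_{\max}\mid F\gamma_x(\hat z)+G\gamma_u(\hat z)=0\}.$$ (ii) For pairs $F,G\in\mathbb{C}^{2\times2}$ and $F',G'\in\mathbb{C}^{2\times2}$ each satisfying $(\ast)$, we have $T_{F,G}=T_{F',G'}$ if and only if $F'=CF$ and $G'=CG$ for some invertible matrix $C\in\mathbb{C}^{2\times2}$. (iii) A linear relation $T$ is a self-adjoint extension of $T_{\min}$ if and only if there exists a unitary matrix $V\in\mathbb{C}^{2\times2}$ such that $$T=T_V:=\{\{\tilde z,\tilde f\}\in T_{\max}\mid i(V-I)\gamma_x(\hat z)=(V+I)\gamma_u(\hat z)\}.$$ (iv) For unitary matrices $V,V'\in\mathbb{C}^{2\times2}$, we have $T_V=T_{V'}$ if and only if $V'=V$.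
   Context: Here $\mathcal{J}=\begin{pmatrix}0&1\\-1&0\end{pmatrix}$, $\mathcal{I}=\{0,\dots,N\}$, $\mathcal{I}^+=\{0,\dots,N+1\}$. For each $k\in\mathcal{I}$ let $\mathcal{S}_k,\Psi_k\in\mathbb{C}^{2\times2}$ satisfy $\mathcal{S}_k^*\mathcal{J}\mathcal{S}_k=\mathcal{J}$, $\Psi_k^*=\Psi_k$, $\Psi_k^*\mathcal{J}\Psi_k=0$, $\Psi_k\ge0$ (positive semidefinite). Put $\mathcal{V}_k=-\mathcal{J}\Psi_k\mathcal{S}_k$. The system $(S_\lambda)$ is $z_k=(\mathcal{S}_k+\lambda\mathcal{V}_k)z_{k+1}$, $k\in\mathcal{I}$, for $z:\mathcal{I}^+\to\mathbb{C}^2$. Let $\mathscr{L}(z)_k=\mathcal{J}(z_k-\mathcal{S}_kz_{k+1})$, $k\in\mathcal{I}$. Strong Atkinson condition (SAC): there is an interval $\{a,\dots,b\}\subseteq\mathcal{I}$ such that for every $\lambda\in\mathbb{C}$ every nontrivial solution $z$ of $(S_\lambda)$ satisfies $\sum_{k=a}^bz_k^*\Psi_kz_k>0$. Put $\langle z,u\rangle_\Psi=\sum_{k\in\mathcal{I}}z_k^*\Psi_ku_k$, $\|z\|_\Psi=\sqrt{\langle z,z\rangle_\Psi}$, and let $\tilde\ell^2_\Psi$ be the Hilbert space of equivalence classes of sequences $z:\mathcal{I}^+\to\mathbb{C}^2$ modulo $\{z:\|z\|_\Psi=0\}$. A linear relation is a linear subspace $T\subseteq\tilde\ell^2_\Psi\times\tilde\ell^2_\Psi$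 of pairs $\{\tilde z,\tilde f\}$; its adjoint is $T^*=\{\{\tilde y,\tilde g\}:\langle\tilde z,\tilde g\rangle_\Psi=\langle\tilde f,\tilde y\rangle_\Psi\ \forall\{\tilde z,\tilde f\}\in T\}$. $T$ is a self-adjoint extension of $T'$ if $T'\subseteq T=T^*$. $T_{\max}=\{\{\tilde z,\tilde f\}:\exists u\in\tilde z,\ \mathscr{L}(u)_k=\Psi_kf_k\ \forall k\in\mathcal{I}\}$. Under (SAC) this $u$ is unique for each pair $\{\tilde z,\tilde f\}\in T_{\max}$ and is denoted $\hat z$ (it is determined by the pair). $T_{\min}=\overline{T_0}$, where $T_0$ is the set of $\{\tilde z,\tilde f\}$ for which there is $u\in\tilde z$ with $u_0=0=u_{N+1}$ and $\mathscr{L}(u)_k=\Psi_kf_k$ for all $k\in\mathcal{I}$. Boundary trace maps: for $P=\begin{pmatrix}\cos\alpha_0&\sin\alpha_0\\0&0\end{pmatrix}$ and $Q=\begin{pmatrix}0&0\\-\sin\alpha_{N+1}&\cos\alpha_{N+1}\end{pmatrix}$ put $\gamma_{P,Q}(\hat z)=P\hat z_0-Q\hat z_{N+1}$. Then $\gamma_x:=\gamma_{P,Q}$ with $\alpha_0=0,\alpha_{N+1}=\pi/2$ and $\gamma_u:=\gamma_{P,Q}$ with $\alpha_0=\pi/2,\alpha_{N+1}=0$; explicitly, with $\hat z_k=(\hat x_k,\hat u_k)^\top$, $\gamma_x(\hat z)=(\hat x_0,\hat x_{N+1})^\top$ and $\gamma_u(\hat z)=(\hat u_0,-\hat u_{N+1})^\top$.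 $(F,G)$ denotes the $2\times4$ matrix with blocks $F$ and $G$. *)

(* Defs.v *)
From HB Require Import structures.
From mathcomp Require Import all_boot all_order all_algebra.
From mathcomp Require Import sesquilinear spectral.
From mathcomp Require Import ring_quotient generic_quotient.
From mathcomp Require Import complex.
From mathcomp Require Import all_classical all_reals all_analysis.

Set Implicit Arguments.
Unset Strict Implicit.
Unset Printing Implicit Defensive.

Import Order.TTheory GRing.Theory Num.Theory.
Import numFieldNormedType.Exports.

Local Open Scope classical_set_scope.
Local Open Scope quotient_scope.
Local Open Scope ring_scope.
Local Open Scope sesquilinear_scope.

Section SemiInnerProduct.
Variables (C : numClosedFieldType) (V : lmodType C) (b : V -> V -> C).
Hypothesis bDr : forall u v w, b u (v + w) = b u v + b u w.
Hypothesis bZr : forall a u v, b u (a *: v) = a * b u v.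
Hypothesis bC : forall u v, b u v = (b v u)^*.
Hypothesis b_ge0 : forall u, 0 <= b u u.

Let bDl u v w : b (u + v) w = b u w + b v w.
Proof. by rewrite bC bDr rmorphD /= -!bC. Qed.

Let bZl a u v : b (a *: u) v = a^* * b u v.
Proof. by rewrite bC bZr rmorphM /= -bC. Qed.

Let bZZ a c u v : b (a *: u + c *: v) (a *: u + c *: v) =
  a^* * a * b u u + a^* * c * b u v + c^* * a * b v u + c^* * c * b v v.
Proof. by rewrite !(bDl, bDr, bZl, bZr) !mulrDr !mulrA !addrA. Qed.

Let b_real u : (b u u)^* = b u u. Proof. by rewrite -bC. Qed.

Let CS_pos u v : 0 < b v v -> `|b u v| ^+ 2 <= b u u * b v v.
Proof.
move=> v_gt0; have := b_ge0 (b v v *: u + (- b v u) *: v).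
rewrite bZZ rmorphN /= b_real -(bC u v).
have -> : b v v * b v v * b u u + b v v * - b v u * b u v
    + - b u v * b v v * b v u + - b u v * - b v u * b v v
  = b v v * (b u u * b v v - b u v * b v u).
  rewrite mulrBr !mulrN !mulNr opprK -addrA [X in _ + X = _]addrC.
  have -> : b u v * b v v * b v u = b u v * b v u * b v v by rewrite mulrAC.
  rewrite subrr addr0; congr (_ - _); first by rewrite mulrAC mulrA.
  by rewrite -mulrA [b v u * _]mulrC.
by rewrite pmulr_rge0 // subr_ge0 normCK (bC v u).
Qed.

Lemma semi_CauchySchwarz u v : `|b u v| ^+ 2 <= b u u * b v v.
Proof.
have [v0|] := eqVneq (b v v) 0; last first.
  by move=> v0; apply: CS_pos; rewrite lt_def v0 b_ge0.
have [u0|u0] := eqVneq (b u u) 0; last first.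
  by rewrite bC norm_conjC [leRHS]mulrC CS_pos // lt_def u0 b_ge0.
have := b_ge0 (1 *: u + (- b v u) *: v).
rewrite bZZ u0 v0 !mulr0 addr0 add0r rmorphN /= -(bC u v) conjC1 mul1r mulr1.
rewrite !mulNr [b v u * _]mulrC -opprD oppr_ge0 -mulr2n (bC v u) -normCK.
by rewrite pmulrn_lle0.
Qed.

Lemma semi_norm_triangle u v :
  sqrtC (b (u + v) (u + v)) <= sqrtC (b u u) + sqrtC (b v v).
Proof.
have s0 w : 0 <= sqrtC (b w w) by rewrite sqrtC_ge0.
rewrite -ler_sqr ?nnegrE ?addr_ge0 // sqrrD !sqrtCK bDl !bDr.
rewrite [X in X <= _](_ : _ = b u u + (b u v + b v u) + b v v); last first.
  by rewrite !addrA.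
rewrite lerD2r lerD2l.
have -> : b u v + b v u = 'Re (b u v) *+ 2.
  by rewrite (bC v u) /= ReE -[RHS]mulr_natr divfK ?pnatr_eq0.
rewrite lerMn2r /=; apply: (le_trans (real_ler_norm (Creal_Re _))).
apply: (le_trans (y := `|b u v|)).
  by have [] := leif_normC_Re_Creal (b u v).
rewrite -ler_sqr ?nnegrE ?mulr_ge0 // exprMn !sqrtCK.
exact: semi_CauchySchwarz.
Qed.

Lemma semi_norm_scale a u :
  sqrtC (b (a *: u) (a *: u)) = `|a| * sqrtC (b u u).
Proof.
rewrite bZl bZr mulrA [_^* * _]mulrC -normCK sqrtCM ?nnegrE ?exprn_ge0 //.
by rewrite sqrCK.
Qed.

End SemiInnerProduct.

Definition mx2 (T : nzRingType) (a b c d : T) : 'M[T]_2 :=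
  \matrix_(i, j) nth 0 (nth [::] [:: [:: a; b]; [:: c; d]] i) j.

Definition Jmx (R : realType) : 'M[R[i]]_2 := mx2 0 1 (- 1) 0.

(* On R[i], 0 <= c means that c is real and nonnegative. *)
Record system (R : realType) (N : nat) := System {
  Smx : 'I_N.+1 -> 'M[R[i]]_2;
  Psi : 'I_N.+1 -> 'M[R[i]]_2;
  Smx_symplectic : forall k, (Smx k)^t* *m Jmx R *m Smx k = Jmx R;
  Psi_hermitian : forall k, (Psi k)^t* = Psi k;
  Psi_isotropic : forall k, (Psi k)^t* *m Jmx R *m Psi k = 0;
  Psi_ge0 : forall k (v : 'cV[R[i]]_2), 0 <= (v^t* *m Psi k *m v) 0 0
}.

Definition sequence (R : realType) (N : nat) := {ffun 'I_N.+2 -> 'cV[R[i]]_2}.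

(* For k in I = 'I_N.+1, the positions k and k + 1 in I^+ = 'I_N.+2. *)
Definition cur N (k : 'I_N.+1) : 'I_N.+2 := widen_ord (leqnSn N.+1) k.
Definition nxt N (k : 'I_N.+1) : 'I_N.+2 := lift ord0 k.

Section System.
Variables (R : realType) (N : nat) (D : system R N).
Local Notation C := R[i].
Local Notation seqC := (sequence R N).
Implicit Types (z u f : seqC) (k : 'I_N.+1).

Definition Vmx k : 'M[C]_2 := - Jmx R *m Psi D k *m Smx D k.

Definition solution (lam : C) z : Prop :=
  forall k, z (cur k) = (Smx D k + lam *: Vmx k) *m z (nxt k).

Definition Lop z k : 'cV[C]_2 := Jmx R *m (z (cur k) - Smx D k *m z (nxt k)).

Definition psiform k z u : C :=
  ((z (cur k))^t* *m Psi D k *m u (cur k)) 0 0.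

Definition SAC : Prop :=
  exists a b : 'I_N.+1, (a <= b)%N /\
    forall (lam : C) z, solution lam z -> z != 0 ->
      0 < \sum_(k < N.+1 | (a <= k <= b)%N) psiform k z z.

Definition dotp z u : C := \sum_(k < N.+1) psiform k z u.

Definition psinorm z : C := sqrtC (dotp z z).

Lemma psiformDr k z u f : psiform k z (u + f) = psiform k z u + psiform k z f.
Proof. by rewrite /psiform ffunE mulmxDr mxE. Qed.

Lemma psiformZr k a z u : psiform k z (a *: u) = a * psiform k z u.
Proof. by rewrite /psiform ffunE -scalemxAr mxE. Qed.

Lemma psiformC k z u : psiform k z u = (psiform k u z)^*.
Proof.
rewrite /psiform -[in LHS](Psi_hermitian D k).
set x := z _; set y := u _.
have -> : x^t* *m (Psi D k)^t* *m y = (y^t* *m Psi D k *m x)^t*.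
  by rewrite !trmx_mul !map_mxM /= trmxCK mulmxA.
by rewrite !mxE.
Qed.

Lemma dotpDr z u f : dotp z (u + f) = dotp z u + dotp z f.
Proof. by rewrite -big_split; apply: eq_bigr => k _; exact: psiformDr. Qed.

Lemma dotpZr a z u : dotp z (a *: u) = a * dotp z u.
Proof. by rewrite mulr_sumr; apply: eq_bigr => k _; exact: psiformZr. Qed.

Lemma dotpC z u : dotp z u = (dotp u z)^*.
Proof. by rewrite rmorph_sum; apply: eq_bigr => k _; exact: psiformC. Qed.

Lemma dotp_ge0 z : 0 <= dotp z z.
Proof. by apply: sumr_ge0 => k _; exact: Psi_ge0. Qed.

Lemma psinorm_triangle z u : psinorm (z + u) <= psinorm z + psinorm u.
Proof. exact: (semi_norm_triangle dotpDr dotpZr dotpC dotp_ge0). Qed.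

Lemma psinormZ a z : psinorm (a *: z) = `|a| * psinorm z.
Proof. exact: (semi_norm_scale dotpZr dotpC dotp_ge0). Qed.

Lemma psinorm_ge0 z : 0 <= psinorm z.
Proof. by rewrite sqrtC_ge0 dotp_ge0. Qed.

Definition null : {pred seqC} := fun z => psinorm z == 0.

Lemma null_submod : submod_closed null.
Proof.
split=> [|a z u]; rewrite !unfold_in /null.
  by rewrite -(scale0r (0 : seqC)) psinormZ normr0 mul0r.
move=> /eqP z0 /eqP u0; rewrite eq_le psinorm_ge0 andbT.
by rewrite (le_trans (psinorm_triangle _ _)) // psinormZ z0 u0 mulr0 addr0.
Qed.

HB.instance Definition _ :=
  GRing.isZmodClosed.Build seqC null (GRing.submod_closedB null_submod).

(* The quotient space of sequences modulo {z | psinorm z = 0}. *)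
Definition ltilde := Quotient.quot null.

HB.instance Definition _ := Choice.on ltilde.
HB.instance Definition _ := GRing.Zmodule.on ltilde.

Definition cls z : ltilde := \pi_(Quotient.quot null) z.
Definition rep (x : ltilde) : seqC := repr (x : Quotient.quot null).

Lemma repK x : cls (rep x) = x.
Proof. exact: reprK. Qed.

Lemma cls_eq z u : (cls z = cls u) <-> (psinorm (z - u) = 0).
Proof.
split=> [/eqP|zu]; last apply/eqP.
  by rewrite /cls -Quotient.idealrBE => /eqP.
by rewrite /cls -Quotient.idealrBE; apply/eqP.
Qed.

Lemma clsD z u : cls (z + u) = cls z + cls u.
Proof. by rewrite /cls piE. Qed.

Lemma cls0 : cls 0 = 0.
Proof. by rewrite /cls piE. Qed.

Definition lscale (a : C) (x : ltilde) : ltilde := cls (a *: rep x).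

Lemma lscale_cls a z : lscale a (cls z) = cls (a *: z).
Proof.
apply/cls_eq; rewrite -scalerBr psinormZ.
by have /cls_eq -> := repK (cls z); rewrite mulr0.
Qed.

Lemma lscaleA a b x : lscale a (lscale b x) = lscale (a * b) x.
Proof. by rewrite -[x]repK !lscale_cls scalerA. Qed.

Lemma lscale1 : left_id 1 lscale.
Proof. by move=> x; rewrite -[x]repK lscale_cls scale1r. Qed.

Lemma lscaleDr : right_distributive lscale +%R.
Proof.
move=> a x y; rewrite -[x]repK -[y]repK -clsD !lscale_cls -clsD.
by rewrite scalerDr.
Qed.

Lemma lscaleDl x : {morph lscale^~ x : a b / a + b}.
Proof. by move=> a b; rewrite -[x]repK !lscale_cls -clsD scalerDl. Qed.

HB.instance Definition _ :=
  GRing.Zmodule_isLmodule.Build C ltilde lscaleA lscale1 lscaleDr lscaleDl.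

Lemma clsZ a z : cls (a *: z) = a *: cls z.
Proof. by rewrite -lscale_cls. Qed.

Definition ldot (x y : ltilde) : C := dotp (rep x) (rep y).

Definition lnorm (x : ltilde) : C := sqrtC (ldot x x).

Lemma dotp_null z u : psinorm u = 0 -> dotp z u = 0.
Proof.
move=> /eqP; rewrite /psinorm sqrtC_eq0 => /eqP u0.
have := semi_CauchySchwarz dotpDr dotpZr dotpC dotp_ge0 z u.
rewrite u0 mulr0 => zu0; apply/eqP; rewrite -normr_eq0 -sqrf_eq0 eq_le zu0.
by rewrite exprn_ge0.
Qed.

Lemma ldot_cls z u : ldot (cls z) (cls u) = dotp z u.
Proof.
have cong z' u' f : cls u' = cls f -> dotp z' u' = dotp z' f.
  move=> /cls_eq /(@dotp_null z'); rewrite -scaleN1r dotpDr dotpZr mulN1r.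
  exact: subr0_eq.
rewrite /ldot (cong _ _ u (repK _)) dotpC (cong _ _ z (repK _)).
by rewrite -dotpC.
Qed.

Lemma lnorm_cls z : lnorm (cls z) = psinorm z.
Proof. by rewrite /lnorm ldot_cls. Qed.

Lemma lnorm_triangle x y : lnorm (x + y) <= lnorm x + lnorm y.
Proof.
by rewrite -[x]repK -[y]repK -clsD !lnorm_cls; exact: psinorm_triangle.
Qed.

Lemma lnormZ a x : lnorm (a *: x) = `|a| * lnorm x.
Proof. by rewrite -[x]repK -clsZ !lnorm_cls psinormZ. Qed.

Lemma lnorm0_eq0 x : lnorm x = 0 -> x = 0.
Proof.
by rewrite -[x]repK lnorm_cls -cls0 => x0; apply/cls_eq; rewrite subr0.
Qed.

HB.instance Definition _ :=
  Lmodule_isNormed.Build C ltilde lnorm_triangle lnormZ lnorm0_eq0.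

End System.

Section Relations.
Variables (R : realType) (N : nat) (D : system R N).
Local Notation C := R[i].
Local Notation seqC := (sequence R N).
Local Notation H := (ltilde D).
Implicit Types (z u f : seqC) (k : 'I_N.+1) (p q : H * H).
Implicit Types (T : set (H * H)).

Definition linear_relation T : Prop :=
  T 0 /\ forall (a : C) p q, T p -> T q -> T (a *: p + q).

(* Here p = (y, g) and q = (z, f). *)
Definition adjoint T : set (H * H) :=
  [set p | forall q, T q -> ldot q.1 p.2 = ldot q.2 p.1].

Definition self_adjoint_extension T (T' : set (H * H)) : Prop :=
  T' `<=` T /\ T = adjoint T.

(* u belongs to the class p.1 and solves L(u) = Psi f, where p.2 is the class
   of f; by is_lift_any the choice of f is irrelevant. *)
Definition is_lift p u : Prop :=
  cls D u = p.1 /\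
  exists2 f, cls D f = p.2 & forall k, Lop D u k = Psi D k *m f (cur k).

Definition Tmax : set (H * H) := [set p | exists u, is_lift p u].

Definition Tzero : set (H * H) :=
  [set p | exists u, [/\ is_lift p u, u ord0 = 0 & u ord_max = 0]].

Definition Tmin : set (H * H) := closure Tzero.

(* Well defined on Tmax under SAC, by is_lift_unique. *)
Definition hat p : seqC := xget 0 [set u | is_lift p u].

Lemma psinorm0_Psi z k : psinorm D z = 0 -> Psi D k *m z (cur k) = 0.
Proof.
move=> /eqP; rewrite /psinorm sqrtC_eq0 psumr_eq0; last first.
  by move=> j _; exact: Psi_ge0.
move=> /allP/(_ k); rewrite mem_index_enum => /(_ isT) /eqP zk0.
pose b (v w : 'cV[C]_2) : C := (v^t* *m Psi D k *m w) 0 0.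
have bDr (u v w : 'cV_2) : b u (v + w) = b u v + b u w.
  by rewrite /b mulmxDr mxE.
have bZr a (u v : 'cV_2) : b u (a *: v) = a * b u v.
  by rewrite /b -scalemxAr mxE.
have bC (u v : 'cV_2) : b u v = (b v u)^*.
  rewrite /b -[in LHS](Psi_hermitian D k).
  have -> : u^t* *m (Psi D k)^t* *m v = (v^t* *m Psi D k *m u)^t*.
    by rewrite !trmx_mul !map_mxM /= trmxCK mulmxA.
  by rewrite !mxE.
have b0 w : b w (z (cur k)) = 0.
  have := semi_CauchySchwarz bDr bZr bC (@Psi_ge0 _ _ D k) w (z (cur k)).
  rewrite [b (z _) (z _)]zk0 mulr0 => w0; apply/eqP.
  by rewrite -normr_eq0 -sqrf_eq0 eq_le w0 exprn_ge0.
apply/matrixP => i j; rewrite ord1 [RHS]mxE -(b0 (delta_mx i 0)) /b -mulmxA.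
rewrite trmx_delta map_delta_mx [RHS]mxE (bigD1 i) //= big1 ?addr0.
  by rewrite [X in X * _]mxE !eqxx mul1r ?mxE.
by move=> l li; rewrite [X in X * _]mxE (negPf li) andbF mul0r.
Qed.

Lemma LopP a z u k : Lop D (a *: z + u) k = a *: Lop D z k + Lop D u k.
Proof.
rewrite /Lop !ffunE scalemxAr -mulmxDr; congr (_ *m _).
by rewrite mulmxDr -scalemxAr opprD scalerBr addrACA.
Qed.

Lemma mulJJ : Jmx R *m Jmx R = - 1%:M.
Proof.
apply/matrixP => i j; rewrite !mxE !big_ord_recl big_ord0 !mxE.
by case: i j => [[|[|//]] ?] [[|[|//]] ?];
  rewrite /= ?(mulr0, mul0r, mulr1, mul1r, addr0, add0r, oppr0).
Qed.

Lemma solution0 z : (forall k, Lop D z k = 0) -> solution D 0 z.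
Proof.
move=> Lz k; rewrite scale0r addr0; apply/eqP; rewrite -subr_eq0; apply/eqP.
have /(congr1 (mulmx (Jmx R))) := Lz k; rewrite /Lop mulmxA mulJJ mulmx0.
by rewrite mulNmx mul1mx => /eqP; rewrite oppr_eq0 => /eqP.
Qed.

Lemma is_lift_any p u f : is_lift p u -> cls D f = p.2 ->
  forall k, Lop D u k = Psi D k *m f (cur k).
Proof.
move=> [_ [g gp Lu]] fp k; rewrite Lu; apply/eqP; rewrite -subr_eq0 -mulmxBr.
have /cls_eq/(@psinorm0_Psi _ k) : cls D g = cls D f by rewrite gp fp.
by rewrite !ffunE => ->.
Qed.

Lemma is_lift_linear a p q u v :
  is_lift p u -> is_lift q v -> is_lift (a *: p + q) (a *: u + v).
Proof.
move=> [up [f fp Lu]] [vq [g gq Lv]]; split; first by rewrite clsD clsZ up vq.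
exists (a *: f + g) => [|k]; first by rewrite clsD clsZ fp gq.
by rewrite LopP Lu Lv !ffunE mulmxDr scalemxAr.
Qed.

Lemma is_lift_unique p u u' : SAC D -> is_lift p u -> is_lift p u' -> u = u'.
Proof.
move=> [a [b [_ sac]]] pu pu'; apply/eqP; rewrite -subr_eq0; apply/negPn/negP.
have /cls_eq uu'0 : cls D u = cls D u' by rewrite pu.1 pu'.1.
have Lw k : Lop D (u - u') k = 0.
  have [f fp Lu] := pu.2.
  by rewrite addrC -scaleN1r LopP (is_lift_any pu' fp) Lu scaleN1r addNr.
move=> /(sac 0 _ (solution0 Lw)); rewrite big1 ?ltxx // => k _.
by rewrite /psiform -mulmxA psinorm0_Psi // mulmx0 mxE.
Qed.

Lemma hatP p : Tmax p -> is_lift p (hat p).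
Proof. by case=> u pu; rewrite /hat; case: xgetP => // /(_ u). Qed.

Lemma hat_eq p u : SAC D -> is_lift p u -> hat p = u.
Proof.
move=> sac pu; apply: (is_lift_unique sac _ pu); apply: hatP.
by exists u.
Qed.

Definition Pmx (alpha : R) : 'M[C]_2 :=
  mx2 (cos alpha)%:C%C (sin alpha)%:C%C 0 0.

Definition Qmx (alpha : R) : 'M[C]_2 :=
  mx2 0 0 (- sin alpha)%:C%C (cos alpha)%:C%C.

Definition gammaPQ (P Q : 'M[C]_2) z : 'cV[C]_2 :=
  P *m z ord0 - Q *m z ord_max.

Definition gamma_x : seqC -> 'cV[C]_2 := gammaPQ (Pmx 0) (Qmx (pi / 2)).
Definition gamma_u : seqC -> 'cV[C]_2 := gammaPQ (Pmx (pi / 2)) (Qmx 0).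

Lemma gamma_xE z : gamma_x z = \col_i nth 0 [:: z ord0 0 0; z ord_max 0 0] i.
Proof.
rewrite /gamma_x /gammaPQ /Pmx /Qmx cos0 sin0 cos_pihalf sin_pihalf.
apply/matrixP => i j; rewrite ord1 !mxE !big_ord_recl !big_ord0 !mxE.
by case: i => [[|[|//]] ?] /=;
  rewrite ?(mul1r, mul0r, rmorph0, rmorph1, rmorphN,
    mulN1r, mulNr, opprK, addr0, add0r, oppr0).
Qed.

Lemma gamma_uE z :
  gamma_u z = \col_i nth 0 [:: z ord0 1 0; - z ord_max 1 0] i.
Proof.
rewrite /gamma_u /gammaPQ /Pmx /Qmx cos0 sin0 cos_pihalf sin_pihalf.
apply/matrixP => i j; rewrite ord1 !mxE !big_ord_recl !big_ord0 !mxE.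
case: i => [[|[|//]] ?] /=;
  rewrite ?(mul1r, mul0r, rmorph0, rmorph1, rmorphN,
    mulN1r, mulNr, opprK, addr0, add0r, oppr0).
  by congr (z _ _ _); exact: val_inj.
by congr (- z _ _ _); exact: val_inj.
Qed.

Lemma gammaPQ_linear P Q a z u :
  gammaPQ P Q (a *: z + u) = a *: gammaPQ P Q z + gammaPQ P Q u.
Proof.
by rewrite /gammaPQ !ffunE !mulmxDr -!scalemxAr opprD scalerBr addrACA.
Qed.

Definition admissible (F G : 'M[C]_2) : Prop :=
  \rank (row_mx F G) = 2 /\ F *m G^t* = G *m F^t*.

Definition TFG (F G : 'M[C]_2) : set (H * H) :=
  [set p | Tmax p /\ F *m gamma_x (hat p) + G *m gamma_u (hat p) = 0].

Definition TV (V : 'M[C]_2) : set (H * H) :=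
  [set p | Tmax p /\
    ('i *: (V - 1%:M)) *m gamma_x (hat p) = (V + 1%:M) *m gamma_u (hat p)].

Lemma boundary_linear (phi : seqC -> 'cV[C]_2) : SAC D ->
  (forall a z u, phi (a *: z + u) = a *: phi z + phi u) ->
  linear_relation [set p | Tmax p /\ phi (hat p) = 0].
Proof.
move=> sac phiP; have is_lift0 : is_lift 0 0.
  split; first by rewrite cls0.
  exists 0 => [|k]; first by rewrite cls0.
  by rewrite /Lop !ffunE !mulmx0 subrr mulmx0.
split=> [|a p q [pT phip] [qT phiq]].
  split; first by exists 0.
  rewrite (hat_eq sac is_lift0).
  have := phiP (- 1) 0 0; by rewrite scaler0 addr0 scaleN1r addNr.
have pq := is_lift_linear a (hatP pT) (hatP qT).
split; first by exists (a *: hat p + hat q).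
by rewrite (hat_eq sac pq) phiP phip phiq scaler0 addr0.
Qed.

Lemma boundary_form_linear (F G : 'M[C]_2) (P Q P' Q' : 'M[C]_2) a z u :
  F *m gammaPQ P Q (a *: z + u) + G *m gammaPQ P' Q' (a *: z + u) =
  a *: (F *m gammaPQ P Q z + G *m gammaPQ P' Q' z) +
  (F *m gammaPQ P Q u + G *m gammaPQ P' Q' u).
Proof.
have lin (x y x' y' : 'cV[C]_2) : F *m (a *: x + y) + G *m (a *: x' + y') =
    a *: (F *m x + G *m x') + (F *m y + G *m y').
  by rewrite !mulmxDr -!scalemxAr scalerDr addrACA.
by rewrite !gammaPQ_linear lin.
Qed.

Lemma TFG_linear F G : SAC D -> linear_relation (TFG F G).
Proof.
move=> sac; pose phi z : 'cV[C]_2 := F *m gamma_x z + G *m gamma_u z.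
by apply: (@boundary_linear phi sac) => a z u; exact: boundary_form_linear.
Qed.

Lemma TV_TFG V : TV V = TFG ('i *: (V - 1%:M)) (- (V + 1%:M)).
Proof.
by apply/seteqP; split=> p [pT /eqP e]; split=> //; apply/eqP;
  rewrite mulNmx subr_eq0 in e *.
Qed.

Lemma TV_linear V : SAC D -> linear_relation (TV V).
Proof. by rewrite TV_TFG; exact: TFG_linear. Qed.

End Relations.

Arguments Tmax {R N} D.
Arguments Tzero {R N} D.
Arguments Tmin {R N} D.
Arguments TFG {R N} D F G.
Arguments TV {R N} D V.

(* Main.v *)
Require Import Defs.
From mathcomp Require Import all_boot all_order all_algebra.
From mathcomp Require Import sesquilinear spectral complex.
From mathcomp Require Import all_classical all_reals all_analysis.
From mathcomp Require Import ring.

(* Summation by parts gives a Green identity in which the isotropy of Psi_k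
   removes the quadratic cross terms: for pairs p, q of Tmax, the defect of
   symmetry equals gamma_x(p)^* gamma_u(q) - gamma_u(p)^* gamma_x(q).  Under
   (SAC) the Gram matrix of the solutions of (S_0) is invertible, so the traces
   (gamma_x, gamma_u) map Tmax onto C^4, and the adjoint of T_0 lies in Tmax.
   Self-adjoint extensions thus correspond to the Lagrangian subspaces of C^4
   for this form.  Since
     (x + iu)^*(y + iv) - (x - iu)^*(y - iv) = 2i (x^* v - u^* y),
   these are the graphs x - iu = V (x + iu) of unitary matrices V, which is the
   boundary condition of T_V. *)

Set Implicit Arguments.
Unset Strict Implicit.

Import Order.TTheory GRing.Theory Num.Theory.
Import numFieldNormedType.Exports.

Local Open Scope ring_scope.
Local Open Scope sesquilinear_scope.

(** * Conjugate transposes *)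

Section ConjugateTranspose.
Variable C : numClosedFieldType.

Lemma trmxC_mul m n p (A : 'M[C]_(m, n)) (B : 'M[C]_(n, p)) :
  (A *m B)^t* = B^t* *m A^t*.
Proof. by rewrite trmx_mul map_mxM. Qed.

Lemma trmxC_add m n (A B : 'M[C]_(m, n)) : (A + B)^t* = A^t* + B^t*.
Proof. by rewrite linearD map_mxD. Qed.

Lemma trmxC_opp m n (A : 'M[C]_(m, n)) : (- A)^t* = - A^t*.
Proof. by rewrite linearN map_mxN. Qed.

Lemma trmxC_sub m n (A B : 'M[C]_(m, n)) : (A - B)^t* = A^t* - B^t*.
Proof. by rewrite trmxC_add trmxC_opp. Qed.

Lemma trmxC_scale m n a (A : 'M[C]_(m, n)) : (a *: A)^t* = a^* *: A^t*.
Proof. by rewrite linearZ map_mxZ. Qed.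

Lemma trmxC1 n : (1%:M : 'M[C]_n)^t* = 1%:M.
Proof. by rewrite trmx1 map_mx1. Qed.

Lemma dot_self_eq0 n (v : 'cV[C]_n) : v^t* *m v = 0 -> v = 0.
Proof.
move=> /matrixP/(_ 0 0); rewrite !mxE => /eqP; rewrite psumr_eq0; last first.
  by move=> i _; rewrite !mxE mulrC mul_conjC_ge0.
move=> /allP v0; apply/matrixP => i j; rewrite ord1 mxE; apply/eqP.
have /implyP/(_ isT) := v0 i (mem_index_enum _).
by rewrite !mxE mulrC mul_conjC_eq0.
Qed.

End ConjugateTranspose.

Lemma subr_entry_eq0 (V : zmodType) m n (A B : 'M[V]_(m, n)) i j :
  A = B -> (A - B) i j = 0.
Proof. by move=> ->; rewrite subrr mxE. Qed.

(** Serves to carry an identity to a closure: [|d|] is at most [(a + b) * e] for every positive [e],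
    and [e = |d| / (a + b + 1)] then rules out [d != 0]. *)
Lemma norm_small_eq0 (C : numFieldType) (a b d : C) : 0 <= a -> 0 <= b ->
  (forall e, 0 < e -> exists x y r s,
     [/\ d = x - y, `|x| <= a * r, `|y| <= b * s, r <= e & s <= e]) ->
  d = 0.
Proof.
move=> a0 b0 small; apply/eqP; rewrite -normr_eq0; apply/negPn/negP => d0.
have dpos : 0 < `|d| by rewrite lt_def d0 normr_ge0.
have M0 : 0 < a + b + 1 by rewrite ltr_wpDl ?addr_ge0.
have [x [y [r [s [dE xr ys re se]]]]] := small _ (divr_gt0 dpos M0).
have : `|d| <= (a + b) * (`|d| / (a + b + 1)).
  rewrite {1}dE mulrDl; apply: le_trans (ler_normB _ _) _; apply: lerD.
    by apply: le_trans xr _; exact: ler_wpM2l.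
  by apply: le_trans ys _; exact: ler_wpM2l.
rewrite mulrCA -[leLHS]mulr1 ler_pM2l // ler_pdivlMr // mul1r gerDl.
by rewrite ler10.
Qed.

(** * Lagrangian subspaces as kernels and as graphs of unitary matrices *)

Section LinearAlgebra.
Variables (C : numClosedFieldType) (n : nat).
Implicit Types (F G V : 'M[C]_n) (x u y v w : 'cV[C]_n).

Lemma linear_set_sum m (T : lmodType C) (L : T -> Prop) (f : 'I_m -> T)
    (a : 'I_m -> C) :
  L 0 -> (forall c p q, L p -> L q -> L (c *: p + q)) ->
  (forall i, L (f i)) -> L (\sum_i a i *: f i).
Proof.
move=> L0 LP Lf; elim/big_rec: _ => // i p _; exact: LP.
Qed.

(** A matrix [A] of maximal rank with columns in [L] spans [L], since appending a vector of [L]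
    cannot raise its rank. The conjugate of a vector killed by [A^T] is orthogonal to [L], so [A^T]
    has trivial kernel and the columns of [A] span everything. *)
Lemma linear_set_full (L : 'cV[C]_n -> Prop) :
  L 0 -> (forall c p q, L p -> L q -> L (c *: p + q)) ->
  (forall w, (forall d, L d -> w^t* *m d = 0) -> w = 0) ->
  forall w, L w.
Proof.
move=> L0 LP Lperp.
pose P (r : nat) :=
  `[< exists m (A : 'M[C]_(n, m)), (forall j, L (col j A)) /\ \rank A = r >].
have exP : exists r, P r.
  by exists 0%N; apply/asboolP; exists 0%N, 0; split; [by case|exact: mxrank0].
have leP r : P r -> (r <= n)%N.
  by move=> /asboolP[m [A [_ <-]]]; exact: rank_leq_row.
have [r /asboolP[m [A [LA rA]]] rmax] := ex_maxnP exP leP.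
have subA w : L w -> (w^T <= A^T)%MS.
  move=> Lw; have : P (\rank (row_mx A w)).
    apply/asboolP; exists (m + 1)%N, (row_mx A w); split=> // j.
    case: (split_ordP j) => k ->; rewrite ?colKl ?colKr //.
    by rewrite col_id.
  move=> /rmax; rewrite -rA -!(mxrank_tr A) -mxrank_tr tr_row_mx => rk.
  have sA : (A^T <= col_mx A^T w^T)%MS by rewrite -addsmxE addsmxSl.
  have := mxrank_leqif_sup sA => /geq_leqif; rewrite rk => /esym.
  by apply: submx_trans; rewrite -addsmxE addsmxSr.
have A0 w : A^T *m w = 0 -> w = 0.
  move=> Aw; rewrite -[w]trmxCK; suff -> : w^t* = 0.
    by rewrite trmx0 map_mx0.
  have e : map_mx Num.conj w = 0.
    apply: Lperp => d /subA/submxP[X dX].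
    rewrite map_trmx -map_mx_comp (map_mx_id (fun a => conjCK a)).
    have -> : d = (d^T)^T by rewrite trmxK.
    by rewrite dX -trmx_mul -mulmxA Aw mulmx0 trmx0.
  by rewrite -map_trmx e trmx0.
move=> w; have : (w^T <= A^T)%MS.
  rewrite submxE; apply/eqP; suff -> : cokermx A^T = 0 by rewrite mulmx0.
  apply/row_matrixP => i; apply/matrixP => a b.
  have /matrixP/(_ i 0) : col b (cokermx A^T) = 0.
    by apply: A0; rewrite colE mulmxA mulmx_coker mul0mx.
  by rewrite !mxE.
move=> /submxP[X /(congr1 trmx)]; rewrite trmx_mul !trmxK => ->.
have -> : A *m X^T = \sum_j X^T j 0 *: col j A.
  apply/matrixP => i j; rewrite ord1 mxE summxE; apply: eq_bigr => k _.
  by rewrite !mxE mulrC.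
exact: linear_set_sum.
Qed.

(* The pairs (G^* c, - F^* c) fill the kernel of (F, G), because both spaces
   have dimension n. *)
Lemma isotropic_kernel F G x u :
  \rank (row_mx F G) = n -> F *m G^t* = G *m F^t* ->
  F *m x + G *m u = 0 -> exists c, x = G^t* *m c /\ u = - (F^t* *m c).
Proof.
move=> rFG FG xu.
pose L := row_mx (G^t*)^T (- (F^t*)^T); pose K := kermx (row_mx F G)^T.
have LK : (L <= K)%MS.
  apply/sub_kermxP; rewrite tr_row_mx mul_row_col mulNmx -!trmx_mul.
  by rewrite FG subrr.
have rL : (n <= \rank L)%N.
  have -> : L = map_mx Num.conj (row_mx G (- F)).
    by rewrite /L map_row_mx map_mxN !map_trmx !trmxK.
  rewrite mxrank_map -[leqLHS]rFG.
  have -> : row_mx F G = row_mx G (- F) *m block_mx 0 1%:M (- 1%:M) 0.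
    rewrite mul_row_block !mulmx0 mulmxN !mulmx1 opprK.
    by rewrite add0r addr0.
  exact: mxrankM_maxl.
have KL : (K <= L)%MS.
  have /geq_leqif <- := mxrank_leqif_sup LK.
  by rewrite mxrank_ker mxrank_tr rFG addnK.
have : (row_mx x^T u^T <= L)%MS.
  apply: submx_trans KL; apply/sub_kermxP.
  rewrite tr_row_mx mul_row_col -!trmx_mul.
  by have := congr1 trmx xu; rewrite linearD trmx0.
move=> /submxP[c]; rewrite mul_mx_row => /eq_row_mx[cx cu].
exists c^T; split; apply: trmx_inj; first by rewrite trmx_mul trmxK.
by rewrite linearN /= trmx_mul trmxK -mulmxN.
Qed.

(** Two kernel vectors in the parametrization of [isotropic_kernel] pair to zero by [FG].
    Conversely, pairing with the kernel vector [(G^* e_i, - F^* e_i)] reads off entry [i] of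
    [F x + G u]. *)
Lemma kernel_lagrangian F G x u :
  \rank (row_mx F G) = n -> F *m G^t* = G *m F^t* ->
  F *m x + G *m u = 0 <->
  forall y v, F *m y + G *m v = 0 -> y^t* *m u = v^t* *m x.
Proof.
move=> rFG FG; split=> [xu y v yv|perp].
  have [c [-> ->]] := isotropic_kernel rFG FG xu.
  have [d [-> ->]] := isotropic_kernel rFG FG yv.
  rewrite trmxC_opp !trmxC_mul !trmxCK mulmxN mulNmx; congr (- _).
  by rewrite !mulmxA -(mulmxA _ G) -(mulmxA _ F) FG.
apply/matrixP => i j; rewrite ord1 [RHS]mxE.
pose c : 'cV[C]_n := delta_mx i 0.
have := perp (G^t* *m c) (- (F^t* *m c)).
rewrite mulmxN !mulmxA FG subrr => /(_ erefl).
rewrite trmxC_opp !trmxC_mul !trmxCK mulNmx.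
move=> /eqP; rewrite -addr_eq0 -!mulmxA -mulmxDr addrC => /eqP.
rewrite trmx_delta map_delta_mx -rowE => /matrixP/(_ 0 0).
by rewrite !mxE.
Qed.

(** The columns of a cokernel matrix of [(F, G)] lie in the kernel of [(F, G)], so an inclusion of
    kernels reverses to one of row spaces. Equal row spaces differ by an invertible left factor. *)
Lemma eq_kernel_row_mx F G F' G' :
  (forall x u, F *m x + G *m u = 0 <-> F' *m x + G' *m u = 0) ->
  exists2 P, P \in unitmx & F' = P *m F /\ G' = P *m G.
Proof.
have sub F1 G1 F2 G2 :
    (forall x u, F1 *m x + G1 *m u = 0 -> F2 *m x + G2 *m u = 0) ->
    (row_mx F2 G2 <= row_mx F1 G1)%MS.
  move=> k12; rewrite submxE; apply/eqP/matrixP => i j.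
  set Z := cokermx _.
  have : F2 *m usubmx (col j Z) + G2 *m dsubmx (col j Z) = 0.
    apply: k12; rewrite -mul_row_col vsubmxK colE mulmxA mulmx_coker.
    by rewrite mul0mx.
  rewrite -mul_row_col vsubmxK colE mulmxA -colE => /matrixP/(_ i 0).
  by rewrite !mxE.
move=> k12.
have : (row_mx F' G' == row_mx F G)%MS.
  by apply/andP; split; apply: sub => x u /k12.
case/eqmxMunitP => P uP; rewrite mul_mx_row => /eq_row_mx[-> ->].
by exists P.
Qed.

(** Stated for matrices because [lagrangian_cayley] applies it to all basis vectors at once. *)
Lemma cayley_form m p (x u : 'M[C]_(n, m)) (y v : 'M[C]_(n, p)) :
  (x + 'i *: u)^t* *m (y + 'i *: v) - (x - 'i *: u)^t* *m (y - 'i *: v) =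
  (2 * 'i) *: (x^t* *m v - u^t* *m y).
Proof.
have ii : - 'i * 'i = 1 :> C by rewrite mulNr -expr2 sqrCi opprK.
rewrite trmxC_add trmxC_sub trmxC_scale conjCi.
rewrite !mulmxDl !mulmxDr !mulNmx !mulmxN -!scalemxAl -!scalemxAr.
rewrite !scalerA ii scale1r.
move: (x^t* *m y) (u^t* *m v) (x^t* *m v) (u^t* *m y) => a b c d.
by apply/matrixP => i j; rewrite !mxE; ring.
Qed.

Lemma cayley_isotropic x u y v :
  (x + 'i *: u)^t* *m (y + 'i *: v) = (x - 'i *: u)^t* *m (y - 'i *: v) <->
  x^t* *m v = u^t* *m y.
Proof.
have i2 : 2 * 'i != 0 :> C by rewrite mulf_neq0 ?pnatr_eq0 ?neq0Ci.
split=> [/eqP|] e.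
  apply/eqP; rewrite -subr_eq0 -(inj_eq (scalerI i2)) scaler0 -cayley_form.
  by rewrite subr_eq0.
by apply/eqP; rewrite -subr_eq0 cayley_form e subrr scaler0.
Qed.

(** Both equations say that [V x - x = - i (V u + u)]. *)
Lemma cayley_boundary V x u :
  ('i *: (V - 1%:M)) *m x = (V + 1%:M) *m u <->
  V *m (x + 'i *: u) = x - 'i *: u.
Proof.
have ii : - 'i * 'i = 1 :> C by rewrite mulNr -expr2 sqrCi opprK.
rewrite -scalemxAl mulmxBl mulmxDl !mul1mx mulmxDr -scalemxAr.
move: (V *m x) (V *m u) => a b; split=> e.
  rewrite -[a](subrK x).
  have -> : a - x = - 'i *: (b + u) by rewrite -e scalerA ii scale1r.
  by apply/matrixP => i j; rewrite !mxE; ring.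
have -> : a - x = - 'i *: (b + u).
  rewrite -[a](addrK ('i *: b)) e.
  by apply/matrixP => i j; rewrite !mxE; ring.
by rewrite scalerA mulrC ii scale1r.
Qed.

(** Multiplying the row by the column with blocks [i I] and [I] gives the invertible matrix [-2 V],
    whence full rank. By unitarity both products equal [i (V^* - V)]. *)
Lemma cayley_admissible V : V \is unitarymx ->
  \rank (row_mx ('i *: (V - 1%:M)) (- (V + 1%:M))) = n /\
  ('i *: (V - 1%:M)) *m (- (V + 1%:M))^t* =
  (- (V + 1%:M)) *m ('i *: (V - 1%:M))^t*.
Proof.
move=> Vu; split.
  apply/eqP; rewrite eqn_leq rank_leq_row /=.
  have V2 : -2%:R *: V \in unitmx.
    by rewrite unitmxZ ?unitarymx_unit // unitfE oppr_eq0 pnatr_eq0.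
  rewrite -[leqLHS](mxrank_unit V2).
  have -> : -2%:R *: V = row_mx ('i *: (V - 1%:M)) (- (V + 1%:M)) *m
      col_mx ('i%:M) 1%:M.
    rewrite mul_row_col mulmx1 mul_mx_scalar scalerA -expr2 sqrCi.
    by apply/matrixP => i j; rewrite !mxE; ring.
  exact: mxrankM_maxl.
rewrite trmxC_opp trmxC_scale trmxC_add trmxC_sub trmxC1 conjCi.
rewrite mulmxN mulNmx -scalemxAl -scalemxAr.
rewrite !mulmxDr !mulmxDl !mulNmx !mulmxN (unitarymxP Vu) !mul1mx !mulmx1.
by apply/matrixP => i j; rewrite !mxE; ring.
Qed.

(** On [L] the vectors [x + iu] and [x - iu] have the same inner products, so the first determines
    the second isometrically. Maximality of [L] makes the first range over all of C^n. *)
Lemma lagrangian_cayley (L : 'cV[C]_n -> 'cV[C]_n -> Prop) :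
  (forall c x u y v, L x u -> L y v -> L (c *: x + y) (c *: u + v)) ->
  (forall x u, L x u <-> forall y v, L y v -> y^t* *m u = v^t* *m x) ->
  exists2 V, V \is unitarymx &
    forall x u, L x u <-> V *m (x + 'i *: u) = x - 'i *: u.
Proof.
move=> LP Lperp.
have L0 : L 0 0 by apply/Lperp => y v _; rewrite !mulmx0.
have Liso x u y v : L x u -> L y v ->
    (x + 'i *: u)^t* *m (y + 'i *: v) = (x - 'i *: u)^t* *m (y - 'i *: v).
  by move=> Lxu /Lperp/(_ _ _ Lxu)/cayley_isotropic.
have full w : exists p : 'cV[C]_n * 'cV[C]_n, L p.1 p.2 /\ p.1 + 'i *: p.2 = w.
  move: w; apply: linear_set_full.
  - by exists 0; rewrite /= scaler0 addr0.
  - move=> c _ _ [p [Lp <-]] [q [Lq <-]]; exists (c *: p + q); split.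
      exact: LP.
    by apply/matrixP => i j; rewrite /= !mxE; ring.
  (* If [w] is orthogonal to every [x + iu], the pair [(w/2, - i w/2)], with Cayley images [w] and
     0, lies in [L] by maximality; isotropy with itself gives [w^* w = 0]. *)
  move=> w wL; pose h : C := 2^-1.
  have hs : h *: w + 'i *: (- 'i * h *: w) = w.
    rewrite scalerA mulrA mulrN -expr2 sqrCi opprK mul1r -scalerDl.
    by rewrite -mulr2n -(mulr_natr h) mulVf ?pnatr_eq0 // scale1r.
  have hd : h *: w - 'i *: (- 'i * h *: w) = 0.
    by rewrite scalerA mulrA mulrN -expr2 sqrCi opprK mul1r subrr.
  have Lh : L (h *: w) (- 'i * h *: w).
    apply/Lperp => y v Lyv; apply/cayley_isotropic; rewrite hs hd mulmx0.
    rewrite -[LHS]trmxCK trmxC_mul trmxCK wL ?trmx0 ?map_mx0 //.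
    by exists (y, v).
  apply: dot_self_eq0; have := Liso _ _ _ _ Lh Lh.
  by rewrite hs hd mulmx0.
have [f fP] := choice (fun j : 'I_n => full (delta_mx j 0)).
(* Column [j] of [A] and [U] is the pair of [L] with first Cayley image [e_j]; the second images are
   the columns of [V]. *)
pose A : 'M[C]_n := \matrix_(i, j) (f j).1 i 0.
pose U : 'M[C]_n := \matrix_(i, j) (f j).2 i 0.
have LAU j : L (col j A) (col j U).
  have -> : col j A = (f j).1.
    by apply/matrixP => i k; rewrite ord1 !mxE.
  have -> : col j U = (f j).2.
    by apply/matrixP => i k; rewrite ord1 !mxE.
  by have [] := fP j.
have AU1 : A + 'i *: U = 1%:M.
  apply/matrixP => i j; have /matrixP/(_ i 0) := (fP j).2.
  by rewrite !mxE andbT.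
have mulE (X Y : 'M[C]_n) i j :
    (X^t* *m Y) i j = ((col i X)^t* *m col j Y) 0 0.
  by rewrite !mxE; apply: eq_bigr => k _; rewrite !mxE.
have AUform : A^t* *m U = U^t* *m A.
  apply/matrixP => i j; rewrite !mulE.
  by have /Lperp/(_ _ _ (LAU i)) -> := LAU j.
pose V := A - 'i *: U.
have Vu : V^t* *m V = 1%:M.
  have := cayley_form A U A U; rewrite AUform subrr scaler0 AU1 -/V.
  by rewrite trmxC1 mulmx1 => /eqP; rewrite subr_eq0 => /eqP.
exists V; first exact/unitarymxP/mulmx1C.
have LAw w : L (A *m w) (U *m w).
  pose L2 (p : 'cV[C]_n * 'cV[C]_n) := L p.1 p.2.
  have := @linear_set_sum n _ L2 (fun j => (col j A, col j U)) (fun j => w j 0).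
  have -> : \sum_j w j 0 *: (col j A, col j U) = (A *m w, U *m w).
    have sumE (X : 'M[C]_n) : X *m w = \sum_j w j 0 *: col j X.
      apply/matrixP => i j; rewrite ord1 mxE summxE; apply: eq_bigr => k _.
      by rewrite !mxE mulrC.
    rewrite !sumE; elim/big_rec3: _ => // j p q r _ ->.
    by congr pair.
  by apply=> // c p q; exact: LP.
have VL x u : L x u -> V *m (x + 'i *: u) = x - 'i *: u.
  move=> Lxu; set w := x + 'i *: u.
  (* The difference of [(x, u)] and [(A w, U w)] has first Cayley image 0, so by isotropy its second
     image is 0 too. *)
  have L' : L (- 1 *: (A *m w) + x) (- 1 *: (U *m w) + u) by exact: LP.
  have /(@Liso _ _ _ _ L') := L'.
  have -> : - 1 *: (A *m w) + x + 'i *: (- 1 *: (U *m w) + u) = 0.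
    rewrite -(subrr w) -[in X in _ - X](mul1mx w) -AU1 mulmxDl -scalemxAl /w.
    by move: (A *m _) (U *m _) => a b; apply/matrixP => i j; rewrite !mxE; ring.
  rewrite mulmx0 => /esym/dot_self_eq0 e.
  rewrite /V mulmxBl -scalemxAl; apply/esym/eqP.
  rewrite -subr_eq0 -[X in _ == X]e.
  apply/eqP; move: (A *m _) (U *m _) => a b.
  by apply/matrixP => i j; rewrite !mxE; ring.
move=> x u; split; first exact: VL.
move=> Vxu; apply/Lperp => y v Lyv; apply/cayley_isotropic.
by rewrite -Vxu -(VL _ _ Lyv) trmxC_mul mulmxA -(mulmxA _ _ V) Vu mulmx1.
Qed.

(** For each [w], the pair [x = (w + V w)/2], [u = - i (w - V w)/2] has Cayley images [w] and
    [V w]. *)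
Lemma cayley_graph_inj V V' :
  (forall x u, V *m (x + 'i *: u) = x - 'i *: u ->
     V' *m (x + 'i *: u) = x - 'i *: u) -> V' = V.
Proof.
move=> VV'; pose h : C := 2^-1.
have h2 (w : 'cV[C]_n) : h *: w + h *: w = w.
  by rewrite -scalerDl -mulr2n -(mulr_natr h) mulVf ?pnatr_eq0 // scale1r.
suff mulV w : V' *m w = V *m w.
  apply/matrixP => i j; have /matrixP/(_ i 0) := mulV (delta_mx j 0).
  by rewrite -!colE !mxE.
have ii : 'i * - 'i = 1 :> C by rewrite mulrN -expr2 sqrCi opprK.
have := VV' (h *: w + h *: (V *m w)) (- 'i *: (h *: w - h *: (V *m w))).
rewrite scalerA ii scale1r; set a := h *: w; set b := h *: _.
have -> : a + b + (a - b) = w.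
  by rewrite -(h2 w); apply/matrixP => i j; rewrite !mxE; ring.
have -> : a + b - (a - b) = V *m w.
  by rewrite -(h2 (V *m w)); apply/matrixP => i j; rewrite !mxE; ring.
by apply.
Qed.

End LinearAlgebra.

(** * The Lagrange identity for the system *)

Section System.
Variables (R : realType) (N : nat) (D : system R N).
Local Notation C := R[i].
Local Notation seqC := (Defs.sequence R N).
Local Notation H := (ltilde D).
Implicit Types (z u f g y : seqC) (k : 'I_N.+1) (p q : H * H).

Local Notation gx p := (gamma_x (hat p)).
Local Notation gu p := (gamma_u (hat p)).

Lemma cur_inord k : cur k = inord k.
Proof. by apply: val_inj; rewrite /= inordK // ltnW // ltnS. Qed.

Lemma nxt_inord k : nxt k = inord k.+1.
Proof. by apply: val_inj; rewrite /= inordK // ltnS. Qed.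

Definition solves (z f : seqC) : Prop :=
  forall k, Lop D z k = Psi D k *m f (cur k).

Lemma is_lift_solves z f : solves z f -> is_lift (cls D z, cls D f) z.
Proof. by move=> zf; split=> //; exists f. Qed.

Lemma solves_linear a z f u g :
  solves z f -> solves u g -> solves (a *: z + u) (a *: f + g).
Proof.
by move=> zf ug k; rewrite LopP zf ug !ffunE mulmxDr scalemxAr.
Qed.

Lemma JmxC : (Jmx R)^t* = - Jmx R.
Proof.
apply/matrixP => i j; rewrite !mxE.
by case: i j => [[|[|//]] ?] [[|[|//]] ?] /=;
  rewrite ?oppr0 ?opprK ?rmorphN ?rmorph0 ?rmorph1.
Qed.

Lemma JmxJmx n (A : 'M[C]_(2, n)) : Jmx R *m (Jmx R *m A) = - A.
Proof. by rewrite mulmxA mulJJ mulNmx mul1mx. Qed.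

Lemma solves_step z f k : solves z f ->
  z (cur k) - Smx D k *m z (nxt k) = - Jmx R *m (Psi D k *m f (cur k)).
Proof. by move=> <-; rewrite /Lop mulmxA mulNmx mulJJ opprK mul1mx. Qed.

Definition Jform (v w : 'cV[C]_2) : C := (v^t* *m Jmx R *m w) 0 0.

Lemma lagrange z f u g : solves z f -> solves u g ->
  dotp D z g - dotp D f u =
  Jform (z ord0) (u ord0) - Jform (z ord_max) (u ord_max).
Proof.
move=> zf ug; pose t (k : nat) := - Jform (z (inord k)) (u (inord k)).
have step k : psiform D k z g - psiform D k f u = t k.+1 - t k.
  (* Both increments lie in the range of [J Psi_k], so their pairing reduces to
     [Psi_k^* J Psi_k = 0]. *)
  have cross : (z (cur k) - Smx D k *m z (nxt k))^t* *m Jmx R *m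
      (u (cur k) - Smx D k *m u (nxt k)) = 0.
    rewrite (solves_step _ zf) (solves_step _ ug).
    rewrite (trmxC_mul (- Jmx R)) trmxC_opp JmxC opprK.
    rewrite -[_ *m Jmx R *m Jmx R]mulmxA mulJJ mulmxN mulmx1 !mulNmx mulmxN.
    rewrite opprK.
    rewrite trmxC_mul !mulmxA -(mulmxA ((f _)^t*)) -(mulmxA ((f _)^t*)).
    by rewrite Psi_isotropic mulmx0 mul0mx.
  rewrite /t /psiform -cur_inord -nxt_inord.
  have -> : (z (cur k))^t* *m Psi D k *m g (cur k) =
      (z (cur k))^t* *m Lop D u k by rewrite ug mulmxA.
  have -> : (f (cur k))^t* *m Psi D k *m u (cur k) =
      (Lop D z k)^t* *m u (cur k).
    by rewrite zf trmxC_mul Psi_hermitian.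
  have symp : (Smx D k *m z (nxt k))^t* *m Jmx R *m (Smx D k *m u (nxt k)) =
      (z (nxt k))^t* *m Jmx R *m u (nxt k).
    rewrite trmxC_mul !mulmxA -[in RHS](Smx_symplectic D k).
    by rewrite !mulmxA.
  rewrite /Lop /Jform -symp.
  move: cross; set z0 := z _; set u0 := u _.
  set z1 := Smx _ _ *m z _; set u1 := Smx _ _ *m u _.
  have -> : z0^t* *m (Jmx R *m (u0 - u1)) =
      z0^t* *m Jmx R *m u0 - z0^t* *m Jmx R *m u1.
    by rewrite !mulmxBr !mulmxA.
  have -> : (Jmx R *m (z0 - z1))^t* *m u0 =
      z1^t* *m Jmx R *m u0 - z0^t* *m Jmx R *m u0.
    by rewrite trmxC_mul JmxC mulmxN mulNmx trmxC_sub !mulmxBl opprB.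
  have -> : (z0 - z1)^t* *m Jmx R *m (u0 - u1) =
      z0^t* *m Jmx R *m u0 - z0^t* *m Jmx R *m u1 -
      (z1^t* *m Jmx R *m u0 - z1^t* *m Jmx R *m u1).
    by rewrite trmxC_sub !mulmxBl !mulmxBr.
  move: (z0^t* *m _ *m u0) (z0^t* *m _ *m u1) (z1^t* *m _ *m u0)
    (z1^t* *m _ *m u1) => a b c d /matrixP/(_ 0 0).
  (* The term minus its telescoping value, [(2a - b - c) - (a - d)], is exactly the vanishing cross
     term [a - b - c + d]. *)
  by rewrite !mxE => e; apply: subr0_eq; rewrite -[RHS]e; ring.
rewrite /dotp -sumrB (eq_bigr _ (fun k _ => step k)).
rewrite -(big_mkord xpredT (fun m => t m.+1 - t m)) telescope_sumr //.
have -> : t N.+1 = - Jform (z ord_max) (u ord_max).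
  suff : inord N.+1 = ord_max :> 'I_N.+2 by rewrite /t => ->.
  by apply: val_inj; rewrite /= inordK.
have -> : t 0%N = - Jform (z ord0) (u ord0).
  suff : inord 0 = ord0 :> 'I_N.+2 by rewrite /t => ->.
  by apply: val_inj; rewrite /= inordK.
by rewrite opprK addrC.
Qed.

Lemma exists_solves f (eta : 'cV[C]_2) :
  exists2 z, solves z f & z ord_max = eta.
Proof.
(* Backward recursion: [w m] is the value at index [N + 1 - m], so [w l.+1] uses the coefficients at
   [N - l]. *)
pose fix w (m : nat) : 'cV[C]_2 := if m is l.+1 then
  Smx D (inord (N - l)) *m w l -
  Jmx R *m (Psi D (inord (N - l)) *m f (inord (N - l))) else eta.
exists [ffun k : 'I_N.+2 => w (N.+1 - k)%N]; last by rewrite ffunE subnn.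
move=> k; rewrite /Lop !ffunE.
have kN : (k <= N)%N by rewrite -ltnS.
have -> : (N.+1 - cur k)%N = (N - k).+1 by rewrite subSn.
have -> : (N.+1 - nxt k)%N = (N - k)%N by rewrite subSS.
rewrite /= subKn // inord_val -cur_inord addrAC subrr add0r mulmxN.
by rewrite JmxJmx opprK.
Qed.

Lemma dotpBr z u f : dotp D z (u - f) = dotp D z u - dotp D z f.
Proof. by rewrite -scaleN1r dotpDr dotpZr mulN1r. Qed.

Lemma dotp0r z : dotp D z 0 = 0.
Proof. by rewrite -(scale0r 0) dotpZr mul0r. Qed.

Lemma dotp0l z : dotp D 0 z = 0.
Proof. by rewrite dotpC dotp0r rmorph0. Qed.

Lemma dotp_sumr (I : finType) (F : I -> seqC) z :
  dotp D z (\sum_i F i) = \sum_i dotp D z (F i).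
Proof.
elim/big_rec2: _ => [|i a b _ <-]; first exact: dotp0r.
exact: dotpDr.
Qed.

Lemma JformDr v w w' : Jform v (w + w') = Jform v w + Jform v w' :> C.
Proof. by rewrite /Jform mulmxDr mxE. Qed.

Lemma JformNr v w : Jform v (- w) = - Jform v w :> C.
Proof. by rewrite /Jform mulmxN mxE. Qed.

Lemma Jform0r v : Jform v 0 = 0 :> C.
Proof. by rewrite /Jform mulmx0 mxE. Qed.

Lemma Jform0l v : Jform 0 v = 0 :> C.
Proof. by rewrite /Jform trmx0 map_mx0 !mul0mx mxE. Qed.

Lemma JformE v w : Jform v w = (v 0 0)^* * w 1 0 - (v 1 0)^* * w 0 0 :> C.
Proof.
rewrite /Jform !mxE !big_ord_recl !big_ord0 !mxE !big_ord_recl !big_ord0 !mxE.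
rewrite /=.
have -> : lift ord0 ord0 = 1 :> 'I_2 by apply: val_inj.
by rewrite -/(0 : 'I_2) !(mulr0, mulr1, add0r, addr0, mulrN1, mulNr) addrC.
Qed.

(** The sign in the second entry of [gamma_u] absorbs the minus sign of the right endpoint. *)
Lemma Jform_gamma z u :
  Jform (z ord0) (u ord0) - Jform (z ord_max) (u ord_max) =
  ((gamma_x z)^t* *m gamma_u u - (gamma_u z)^t* *m gamma_x u) 0 0.
Proof.
rewrite !JformE !gamma_xE !gamma_uE !mxE !big_ord_recl !big_ord0 !mxE /=.
by rewrite rmorphN; ring.
Qed.

(** * Closedness of adjoints *)

Lemma ldot_CauchySchwarz (x y : H) : `|ldot x y| <= lnorm x * lnorm y.
Proof.
have pos (w : H) : 0 <= ldot w w by exact: dotp_ge0.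
rewrite -ler_sqr ?nnegrE ?mulr_ge0 ?sqrtC_ge0 // exprMn !sqrtCK.
exact: (semi_CauchySchwarz (@dotpDr _ _ D) (@dotpZr _ _ D) (@dotpC _ _ D)
  (@dotp_ge0 _ _ D)).
Qed.

Lemma lnorm_ge0 (x : H) : 0 <= lnorm x.
Proof. by rewrite -[x]repK lnorm_cls psinorm_ge0. Qed.

Lemma ball_lnorm (x y : H) e : ball x e y -> lnorm (x - y) <= e.
Proof. by rewrite -(@ball_normE _ H) => /ltW. Qed.

Lemma ldotBr (x y w : H) : ldot x (y - w) = ldot x y - ldot x w.
Proof.
rewrite -[x]repK -[y]repK -[w]repK -[- cls D _]scaleN1r -clsZ -clsD !ldot_cls.
by rewrite dotpDr dotpZr mulN1r.
Qed.

(** For [s] in [S] near [p], the symmetry defect of [p] against [q] equals that of [p - s], which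
    Cauchy-Schwarz makes arbitrarily small. *)
Lemma closure_sub_adjoint (S T : set (H * H)) :
  (S `<=` adjoint T -> closure S `<=` adjoint T)%classic.
Proof.
move=> ST p clp q Tq; apply: subr0_eq.
apply: (norm_small_eq0 (lnorm_ge0 q.1) (lnorm_ge0 q.2)) => e e0.
have [s [Ss [/ball_lnorm n1 /ball_lnorm n2]]] := clp _ (nbhsx_ballx p _ e0).
exists (ldot q.1 (p.2 - s.2)), (ldot q.2 (p.1 - s.1)),
  (lnorm (p.2 - s.2)), (lnorm (p.1 - s.1)).
split; [|exact: ldot_CauchySchwarz|exact: ldot_CauchySchwarz|by []|by []].
by rewrite !ldotBr (ST _ Ss _ Tq) opprB addrA subrK.
Qed.

(** * Prescribed boundary values and the adjoint of [Tzero] under (SAC) *)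

Section StrongAtkinson.
Hypothesis sac : SAC D.

(** (SAC) at [lambda = 0] turns the seminorm into a norm on the homogeneous solutions. *)
Lemma SAC_dotp_eq0 z : solves z 0 -> dotp D z z = 0 -> z = 0.
Proof.
move=> zL zz; have [a [b [_ /(_ 0)]]] := sac.
have zs : solution D 0 z.
  by apply: solution0 => k; rewrite zL ffunE mulmx0.
move=> /(_ _ zs) pos; apply/eqP/negPn/negP => /pos.
rewrite big1 ?ltxx // => k _.
by rewrite /psiform -mulmxA psinorm0_Psi ?mulmx0 ?mxE // /psinorm zz sqrtC0.
Qed.

(* The y j form a basis of the solutions of (S_0): the second clause holds
   because their initial values span C^2, the third because, by (SAC), their
   Gram matrix is invertible. *)
Lemma solution_basis : exists y : 'I_2 -> seqC,
  [/\ forall j, solves (y j) 0,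
      forall v : 'cV[C]_2, (forall j, Jform (y j ord0) v = 0) -> v = 0
    & forall b : 'I_2 -> C, exists c : 'I_2 -> C,
        forall i, dotp D (y i) (\sum_j c j *: y j) = b i].
Proof.
have [y yP] := choice (fun j : 'I_2 =>
  (let: ex_intro2 z a b := exists_solves 0 (delta_mx j 0) in
   ex_intro (fun z => solves z 0 /\ z ord_max = delta_mx j 0) z (conj a b))).
have yL j : solves (y j) 0 by have [] := yP j.
have yN j : y j ord_max = delta_mx j 0 by have [] := yP j.
exists y; split=> // [v yv|b].
  pose Y : 'M[C]_2 := \matrix_(i, j) y j ord0 i 0.
  have colY j : col j Y = y j ord0.
    by apply/matrixP => i k; rewrite ord1 !mxE.
  have entry (X Z : 'M[C]_2) i j : (X^t* *m Jmx R *m Z) i j =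
      Jform (col i X) (col j Z).
    rewrite /Jform -!mulmxA !mxE; apply: eq_bigr => k _; rewrite !mxE.
    by congr (_ * _); apply: eq_bigr => l _; rewrite !mxE.
  (* The Lagrange identity makes the form of two homogeneous solutions equal at both ends. The
     fundamental matrix is the identity at [ord_max], so its value [Y] at [ord0] is symplectic, with
     left inverse [- J Y^* J]. *)
  have YJY : Y^t* *m Jmx R *m Y = Jmx R.
    apply/matrixP => i j; rewrite entry !colY.
    have := entry 1%:M 1%:M i j.
    rewrite trmxC1 mul1mx mulmx1 !colE !mul1mx => ->.
    rewrite -!yN; apply: subr0_eq; rewrite -(lagrange (yL i) (yL j)).
    by rewrite dotp0r dotp0l subrr.
  have Yv : Y^t* *m (Jmx R *m v) = 0.
    apply/matrixP => i j; rewrite ord1 [RHS]mxE -(yv i) /Jform -mulmxA -colY.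
    by rewrite !mxE; apply: eq_bigr => k _; rewrite !mxE.
  have YX : (- Jmx R *m (Y^t* *m Jmx R)) *m Y = 1%:M.
    by rewrite -mulmxA YJY mulNmx mulJJ opprK.
  have := mulmx1C YX; move=> /(congr1 (mulmx^~ v)); rewrite mul1mx => <-.
  by rewrite -!mulmxA Yv !mulmx0.
pose G : 'M[C]_2 := \matrix_(i, j) dotp D (y i) (y j).
have GE (c : 'cV[C]_2) i :
    dotp D (y i) (\sum_j c j 0 *: y j) = (G *m c) i 0.
  rewrite dotp_sumr mxE; apply: eq_bigr => j _.
  by rewrite dotpZr mxE mulrC.
have Ginj (c : 'cV[C]_2) : G *m c = 0 -> c = 0.
  move=> Gc; pose z := \sum_j c j 0 *: y j.
  have zL : solves z 0.
    apply: (@linear_set_sum _ _ _ (fun z => solves z 0)) => //.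
      by move=> k; rewrite /Lop !ffunE !mulmx0 subrr mulmx0.
    by move=> a u g uL gL; rewrite -[0 : seqC]addr0 -{1}(scaler0 _ a);
      exact: solves_linear.
  (* [z] is orthogonal to every [y j], hence to itself; its coefficients are then read off at
     [ord_max]. *)
  have z0 : z = 0.
    apply: SAC_dotp_eq0 => //; rewrite dotpC {1}/z dotp_sumr big1 ?rmorph0 //.
    by move=> j _; rewrite dotpZr dotpC GE Gc mxE rmorph0 mulr0.
  apply/matrixP => i j; rewrite ord1.
  have : z ord_max i 0 = 0 by rewrite z0 ffunE mxE.
  rewrite /z sum_ffunE summxE (bigD1 i) //= big1 ?addr0.
    by rewrite !ffunE yN !mxE !eqxx mulr1 => ->.
  by move=> l li; rewrite !ffunE yN !mxE eq_sym (negPf li) mulr0.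
have uG : G \in unitmx.
  rewrite -unitmx_tr -row_free_unit -kermx_eq0; apply/eqP/row_matrixP => i.
  rewrite row0; apply: trmx_inj; rewrite trmx0; apply: Ginj; apply: trmx_inj.
  by rewrite trmx_mul trmxK trmx0 -row_mul mulmx_ker row0.
exists (fun j => (invmx G *m (\col_i b i)) j 0) => i.
by rewrite GE mulmxA mulmxV // mul1mx mxE.
Qed.

(** Solve backward from [eta]. The Lagrange identity against the [y i] fixes the initial value
    through the products of [y i] with [f], and these can be prescribed. *)
Lemma solves_boundary (xi eta : 'cV[C]_2) :
  exists z f, [/\ solves z f, z ord0 = xi & z ord_max = eta].
Proof.
have [y [yL yinj ysurj]] := solution_basis.
have [c cP] := ysurj (fun i =>
  Jform (y i ord0) xi - Jform (y i ord_max) eta).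
set f := \sum_j _ in cP; have [z zf zeta] := exists_solves f eta.
exists z, f; split=> //; apply: subr0_eq; apply: yinj => i.
have := lagrange (yL i) zf; rewrite dotp0l subr0 cP zeta => /addIr.
by rewrite JformDr JformNr => ->; rewrite subrr.
Qed.

(* Correct a solution of L(u) = Psi g by a homogeneous one, so that the
   difference h' from p.1 is orthogonal to all homogeneous solutions.  Then h'
   is in the range of Tzero and also orthogonal to that range, hence null. *)
Lemma adjoint_Tzero_sub : (adjoint (Tzero D) `<=` Tmax D)%classic.
Proof.
move=> p pT; have [y [yL yinj ysurj]] := solution_basis.
have [u ug u0] := exists_solves (rep p.2) 0.
pose h := rep p.1 - u.
have [c cP] := ysurj (fun i => dotp D (y i) h).
set f := \sum_j _ in cP; pose h' := h - f.
have yh' i : dotp D (y i) h' = 0 by rewrite dotpBr cP subrr.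
have [z zh' zN] := exists_solves h' 0.
(* Orthogonality of [h'] to the homogeneous solutions forces the other boundary value to vanish, so
   [(z, h')] belongs to [Tzero]. *)
have z0 : z ord0 = 0.
  apply: yinj => i; have := lagrange (yL i) zh'.
  by rewrite dotp0l yh' zN Jform0r !subr0.
have zT : Tzero D (cls D z, cls D h').
  by exists z; split=> //; exact: is_lift_solves.
have zg : dotp D z (rep p.2) = dotp D h' (rep p.1).
  by have := pT _ zT; rewrite /= -[p.1]repK -[p.2]repK !ldot_cls !repK.
(* The product of [z] with [rep p.2] equals that of [h'] with [rep p.1] by adjointness, and that of
   [h'] with [u] by the Lagrange identity. *)
have h'h : dotp D h' h = 0.
  have := lagrange zh' ug; rewrite z0 zN !Jform0l subr0 => /subr0_eq e.
  by rewrite dotpBr -zg e subrr.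
have h'f : dotp D h' f = 0.
  rewrite dotp_sumr big1 // => i _.
  by rewrite dotpZr dotpC yh' rmorph0 mulr0.
have fL : solves f 0.
  apply: (@linear_set_sum _ _ _ (fun z => solves z 0)) => //.
    by move=> k; rewrite /Lop !ffunE !mulmx0 subrr mulmx0.
  by move=> a v w vL wL; rewrite -[0 : seqC]addr0 -{1}(scaler0 _ a);
    exact: solves_linear.
exists (f + u); split.
  rewrite -[p.1]repK; apply/esym/cls_eq.
  have -> : rep p.1 - (f + u) = h' by rewrite /h' /h opprD addrA addrAC.
  by rewrite /psinorm {2}/h' dotpBr h'h h'f subr0 sqrtC0.
exists (rep p.2); first exact: repK.
move=> k; have := solves_linear 1 fL ug k.
by rewrite !scale1r add0r.
Qed.

Lemma green p q : Tmax D p -> Tmax D q ->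
  ldot p.1 q.2 - ldot p.2 q.1 =
  ((gx p)^t* *m gu q - (gu p)^t* *m gx q) 0 0.
Proof.
move=> /hatP[pz [f fp zf]] /hatP[qu [g gq ug]].
by rewrite -pz -qu -fp -gq !ldot_cls (lagrange zf ug) Jform_gamma.
Qed.

Lemma gamma_surj (x u : 'cV[C]_2) :
  exists p, [/\ Tmax D p, gx p = x & gu p = u].
Proof.
(* The entry [- u 1 0] compensates the sign in [gamma_u]. *)
have [z [f [zf z0 zN]]] := solves_boundary
  (\col_i nth 0 [:: x 0 0; u 0 0] i) (\col_i nth 0 [:: x 1 0; - u 1 0] i).
exists (cls D z, cls D f); have zl := is_lift_solves zf.
rewrite (hat_eq sac zl) gamma_xE gamma_uE z0 zN; split; first by exists z.
  apply/matrixP => i j; rewrite ord1 !mxE /=.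
  by case: i => [[|[|//]] ?] /=; congr (x _ _); exact: val_inj.
apply/matrixP => i j; rewrite ord1 !mxE /= opprK.
by case: i => [[|[|//]] ?] /=; congr (u _ _); exact: val_inj.
Qed.

(** * Self-adjoint extensions through boundary traces *)

Lemma Tzero_gamma p : Tzero D p -> [/\ Tmax D p, gx p = 0 & gu p = 0].
Proof.
move=> [z [zp z0 zN]]; split; first by exists z.
  by rewrite (hat_eq sac zp) /gamma_x /gammaPQ z0 zN !mulmx0 subr0.
by rewrite (hat_eq sac zp) /gamma_u /gammaPQ z0 zN !mulmx0 subr0.
Qed.

(** The adjoint of [T] lies in that of [Tzero], hence in [Tmax], where [green] expresses the defect
    by traces. *)
Lemma adjoint_gamma (T : set (H * H)) p :
  (Tzero D `<=` T)%classic -> (T `<=` Tmax D)%classic ->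
  adjoint T p <->
  Tmax D p /\ forall q, T q -> (gx q)^t* *m gu p = (gu q)^t* *m gx p.
Proof.
move=> T0 TM; split=> [pT|[pM pT] q Tq].
  have pM : Tmax D p by apply: adjoint_Tzero_sub => q /T0; exact: pT.
  split; first exact: pM.
  move=> q Tq.
  have e := green (TM _ Tq) pM; rewrite (pT _ Tq) addrN in e.
  apply: subr0_eq; apply/matrixP => i j.
  by rewrite !ord1 -e [RHS]mxE.
apply: subr0_eq; rewrite (green (TM _ Tq) pM).
exact: subr_entry_eq0 (pT _ Tq).
Qed.

Lemma TFG_self_adjoint F G : admissible F G ->
  self_adjoint_extension (TFG D F G) (Tmin D).
Proof.
move=> [rFG FG].
have T0 : (Tzero D `<=` TFG D F G)%classic.
  by move=> p /Tzero_gamma[pM x0 u0]; split=> //; rewrite x0 u0 !mulmx0 addr0.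
have TM : (TFG D F G `<=` Tmax D)%classic by move=> p [].
have TE : TFG D F G = adjoint (TFG D F G).
  apply/seteqP; split=> p.
    move=> [pM pB]; apply/(adjoint_gamma _ T0 TM); split; first exact: pM.
    move=> q [qM qB].
    have pL := (kernel_lagrangian (gx p) (gu p) rFG FG).1 pB.
    exact: (pL _ _ qB).
  move=> /(adjoint_gamma _ T0 TM)[pM pB]; split; first exact: pM.
  apply/(kernel_lagrangian _ _ rFG FG) => y v yv.
  have [q [qM qx qu]] := gamma_surj y v; rewrite -qx -qu.
  apply: pB; split; first exact: qM.
  by rewrite qx qu.
split; last exact: TE.
(* The extension is itself an adjoint, hence closed, so with [Tzero] it contains [Tmin]. *)
by rewrite [X in (_ `<=` X)%classic]TE; apply: closure_sub_adjoint; rewrite -TE.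
Qed.

Lemma TV_self_adjoint V : V \is unitarymx ->
  self_adjoint_extension (TV D V) (Tmin D).
Proof.
move=> /cayley_admissible[r e]; rewrite TV_TFG; exact: TFG_self_adjoint.
Qed.

(** [T] lies between [Tzero] and [Tmax], so [adjoint_gamma] recovers it from its set [L] of traces,
    and [gamma_surj] makes [L] its own orthogonal for the boundary form. *)
Lemma self_adjoint_TV (T : set (H * H)) : linear_relation T ->
  self_adjoint_extension T (Tmin D) ->
  exists2 V, V \is unitarymx & T = TV D V.
Proof.
move=> [_ Tlin] [TminT TE].
have T0 : (Tzero D `<=` T)%classic.
  by move=> p pT; apply: TminT; exact: subset_closure.
have TM : (T `<=` Tmax D)%classic.
  move=> p; rewrite TE => pT; apply: adjoint_Tzero_sub => q /T0; exact: pT.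
have TP p : T p <->
    Tmax D p /\ forall q, T q -> (gx q)^t* *m gu p = (gu q)^t* *m gx p.
  by rewrite {1}TE; exact: adjoint_gamma.
pose L (x u : 'cV[C]_2) := exists p, [/\ T p, gx p = x & gu p = u].
have LP c (x u y v : 'cV[C]_2) :
    L x u -> L y v -> L (c *: x + y) (c *: u + v).
  move=> [p [pT <- <-]] [q [qT <- <-]].
  exists (c *: p + q); split; first exact: Tlin.
    rewrite (hat_eq sac (is_lift_linear c (hatP (TM _ pT)) (hatP (TM _ qT)))).
    exact: gammaPQ_linear.
  rewrite (hat_eq sac (is_lift_linear c (hatP (TM _ pT)) (hatP (TM _ qT)))).
  exact: gammaPQ_linear.
have LE (x u : 'cV[C]_2) : L x u <->
    forall (y v : 'cV[C]_2), L y v -> y^t* *m u = v^t* *m x.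
  split=> [[p [/TP[_ pT] <- <-]] y v [q [qT <- <-]]|Lxu]; first exact: pT.
  have [p [pM px pu]] := gamma_surj x u; exists p; split=> //.
  apply/TP; split; first exact: pM.
  by move=> q qT; rewrite px pu; apply: Lxu; exists q.
have [V Vu VL] := lagrangian_cayley LP LE; exists V => //.
apply/seteqP; split=> p.
  move=> pT; split; first exact: TM.
  by apply/cayley_boundary/VL; exists p.
move=> [pM /cayley_boundary/VL/LE pL]; apply/TP; split; first exact: pM.
by move=> q qT; apply: pL; exists q.
Qed.

(** Surjectivity of the traces turns equal relations into equal kernels of [(F, G)] and
    [(F', G')]. *)
Lemma TFG_eq F G F' G' : TFG D F G = TFG D F' G' <->
  exists K, [/\ K \in unitmx, F' = K *m F & G' = K *m G].
Proof.
have sub F1 G1 F2 G2 (x u : 'cV[C]_2) : TFG D F1 G1 = TFG D F2 G2 ->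
    F1 *m x + G1 *m u = 0 -> F2 *m x + G2 *m u = 0.
  move=> e; have [p [pM <- <-]] := gamma_surj x u => pB.
  have : TFG D F1 G1 p by exact: conj pM pB.
  by rewrite e => -[].
split=> [e|[K [Ku -> ->]]].
  have [x u|K Ku [FK GK]] := @eq_kernel_row_mx _ _ F G F' G'; last by exists K.
  by split; apply: sub.
have KE (x u : 'cV[C]_2) : K *m F *m x + K *m G *m u = K *m (F *m x + G *m u).
  by rewrite mulmxDr !mulmxA.
apply/seteqP; split=> p [pM pB]; split=> //; rewrite KE in pB *.
  by rewrite pB mulmx0.
by rewrite -[LHS](mulKmx Ku) pB mulmx0.
Qed.

Lemma TV_inj V V' : TV D V = TV D V' -> V' = V.
Proof.
move=> e; apply: cayley_graph_inj => x u /cayley_boundary.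
have [p [pM <- <-]] := gamma_surj x u => pB.
have : TV D V p by exact: conj pM pB.
by rewrite e => -[_ /cayley_boundary].
Qed.

End StrongAtkinson.
End System.

Theorem theorem3p11 (R : realType) (N : nat) (D : system R N) (sac : SAC D) :
  [/\ (forall T : set (ltilde D * ltilde D), linear_relation T ->
         self_adjoint_extension T (Tmin D) <->
         exists F G : 'M[R[i]]_2, admissible F G /\ T = TFG D F G),
      (forall F G F' G' : 'M[R[i]]_2, admissible F G -> admissible F' G' ->
         TFG D F G = TFG D F' G' <->
         exists C : 'M[R[i]]_2,
           [/\ C \in unitmx, F' = C *m F & G' = C *m G]),
      (forall T : set (ltilde D * ltilde D), linear_relation T ->
         self_adjoint_extension T (Tmin D) <->
         exists V : 'M[R[i]]_2, V \is unitarymx /\ T = TV D V)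
    & (forall V V' : 'M[R[i]]_2, V \is unitarymx -> V' \is unitarymx ->
         TV D V = TV D V' <-> V' = V)].
Proof.
split.
- move=> T Tlin; split=> [/(self_adjoint_TV sac Tlin)[V Vu ->]|[F [G [FG ->]]]].
    (* Clause (i) passes through the unitary description, whose boundary condition is a special
       admissible pair. *)
    exists ('i *: (V - 1%:M)), (- (V + 1%:M)); split; last exact: TV_TFG.
    exact: cayley_admissible.
  exact: TFG_self_adjoint.
- by move=> F G F' G' _ _; exact: TFG_eq.
- move=> T Tlin; split=> [/(self_adjoint_TV sac Tlin)[V Vu ->]|[V [Vu ->]]].
    by exists V.
  exact: TV_self_adjoint.
by move=> V V' _ _; split=> [|->] //; exact: TV_inj.
Qed.
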